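(* Let $(M,g_0,J_0)$ be a Kähler manifold with Kähler form $\omega_0$. Then there exists a smooth compactly supported deformation $J_t$ of $J_0$ such that for all sufficiently small $t\ne0$: (1) $J_t$ is $\omega_0$-compatible; (2) $J_t$ is not integrable. Consequently $(M,g_t,J_t)$ is strictly almost Kähler, where $g_t(u,v):=\omega_0(u,J_tv)$.
   Context: The Kähler form is $\omega_0(u,v)=g_0(J_0u,v)$. A smooth compactly supported deformation of $J_0$ is a family $(J_t)$ of almost complex structures on $M$, depending smoothly on $t$ in an interval around $0$, with $J_t|_{t=0}=J_0$ and $J_t=J_0$ outside a fixed compact subset of $M$. $J_t$ is $\omega_0$-compatible if $g_t(u,v):=\omega_0(u,J_tv)$ is a $J_t$-invariant Riemannian metric. An almost Kähler manifold is an almost-Hermitian manifold $(M,g,J)$ whose fundamental $2$-form $\omega(u,v)=g(Ju,v)$ is closed; it is Kähler if in addition $J$ is integrable, and strictly almost Kähler if $J$ is not integrable.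
   Formalization: The Kähler manifold is assumed nonempty and of complex dimension at least 2, since in complex dimension 0 or 1 (and on the empty manifold) every almost complex structure is integrable, so (2) fails. *)

(* Defs.v *)
From mathcomp Require Import all_boot all_order all_algebra.
From mathcomp Require Import all_classical all_reals all_analysis.

Set Implicit Arguments.
Unset Strict Implicit.
Unset Printing Implicit Defensive.

Import Order.TTheory GRing.Theory Num.Theory.
Import numFieldNormedType.Exports.
Local Open Scope classical_set_scope.
Local Open Scope ring_scope.

(* C^k and C^oo maps on an open set U.  In finite dimension, C^(k+1) means
   (Frechet) differentiable with all directional derivatives of class C^k. *)
Fixpoint Ck_on (R : realType) (V W : normedModType R) (U : set V) (k : nat)
    (f : V -> W) : Prop :=
  if k is k'.+1 then
    (forall x, U x -> differentiable f x) /\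
    (forall v, Ck_on U k' (fun x => 'D_v f x))
  else forall x, U x -> {for x, continuous f}.

Definition smooth_on (R : realType) (V W : normedModType R) (U : set V)
    (f : V -> W) : Prop :=
  forall k, Ck_on U k f.

(* The values of chart_map outside chart_dom, and of chart_inv outside the
   image of chart_dom, are irrelevant. *)
Record chart (R : realType) (M : topologicalType) (n : nat) := Chart {
  chart_dom : set M;
  chart_map : M -> 'rV[R]_n;
  chart_inv : 'rV[R]_n -> M;
  chart_dom_open : open chart_dom;
  chart_cod_open : open (chart_map @` chart_dom);
  chart_mapK : forall p, chart_dom p -> chart_inv (chart_map p) = p;
  chart_map_cont : forall p, chart_dom p -> {for p, continuous chart_map};
  chart_inv_cont :
    forall x, (chart_map @` chart_dom) x -> {for x, continuous chart_inv} }.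

Definition chart_cod (R : realType) (M : topologicalType) (n : nat)
    (c : chart R M n) : set 'rV[R]_n :=
  chart_map c @` chart_dom c.

Definition transition (R : realType) (M : topologicalType) (n : nat)
    (c d : chart R M n) : 'rV[R]_n -> 'rV[R]_n :=
  chart_map d \o chart_inv c.

Definition compatible_charts (R : realType) (M : topologicalType) (n : nat)
    (c d : chart R M n) : Prop :=
  smooth_on (chart_map c @` (chart_dom c `&` chart_dom d)) (transition c d) /\
  smooth_on (chart_map d @` (chart_dom d `&` chart_dom c)) (transition d c).

Record manifold (R : realType) (n : nat) := Manifold {
  carrier :> topologicalType;
  manifold_hausdorff : hausdorff_space carrier;
  manifold_second_countable : @second_countable carrier;
  atlas : set (chart R carrier n);
  atlas_cover : forall p : carrier, exists2 c, atlas c & chart_dom c p;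
  atlas_compatible : forall c d, atlas c -> atlas d -> compatible_charts c d;
  atlas_maximal :
    forall c, (forall d, atlas d -> compatible_charts c d) -> atlas c }.

(* Tensor fields are given by their expressions in the charts of the (maximal)
   atlas: T c p is the expression of T at p in the coordinates of the chart c,
   meaningful only if c is in the atlas and p in its domain; the expressions at
   a point correspond to each other under the differentials of the transition
   maps. *)
Definition endo_field (R : realType) (n : nat) (M : manifold R n) :=
  chart R M n -> M -> 'rV[R]_n -> 'rV[R]_n.

Definition bilin_field (R : realType) (n : nat) (M : manifold R n) :=
  chart R M n -> M -> 'rV[R]_n -> 'rV[R]_n -> R.

Definition change_coord (R : realType) (M : topologicalType) (n : nat)
    (c d : chart R M n) (p : M) : 'rV[R]_n -> 'rV[R]_n :=
  'd (transition c d) (chart_map c p).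

Definition smooth_endo_field (R : realType) (n : nat) (M : manifold R n)
    (T : endo_field M) : Prop :=
  [/\ forall c p, atlas c -> chart_dom c p -> linear (T c p),
      forall c d p, atlas c -> atlas d -> chart_dom c p -> chart_dom d p ->
        forall v, change_coord c d p (T c p v) = T d p (change_coord c d p v)
    & forall c, atlas c ->
        forall v, smooth_on (chart_cod c) (fun x => T c (chart_inv c x) v)].

Definition smooth_bilin_field (R : realType) (n : nat) (M : manifold R n)
    (b : bilin_field M) : Prop :=
  [/\ forall c p, atlas c -> chart_dom c p ->
        (forall u, scalar (b c p u)) /\ (forall v, scalar (fun u => b c p u v)),
      forall c d p, atlas c -> atlas d -> chart_dom c p -> chart_dom d p ->
        forall u v,
          b c p u v = b d p (change_coord c d p u) (change_coord c d p v)
    & forall c, atlas c ->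
        forall u v, smooth_on (chart_cod c) (fun x => b c (chart_inv c x) u v)].

Definition riemannian_metric (R : realType) (n : nat) (M : manifold R n)
    (g : bilin_field M) : Prop :=
  smooth_bilin_field g /\
  (forall c p, atlas c -> chart_dom c p ->
     (forall u v, g c p u v = g c p v u) /\
     (forall v, v != 0 -> 0 < g c p v v)).

Definition almost_complex (R : realType) (n : nat) (M : manifold R n)
    (J : endo_field M) : Prop :=
  smooth_endo_field J /\
  (forall c p, atlas c -> chart_dom c p -> forall v, J c p (J c p v) = - v).

Definition invariant_form (R : realType) (n : nat) (M : manifold R n)
    (J : endo_field M) (b : bilin_field M) : Prop :=
  forall c p, atlas c -> chart_dom c p ->
    forall u v, b c p (J c p u) (J c p v) = b c p u v.

Definition almost_hermitian (R : realType) (n : nat) (M : manifold R n)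
    (g : bilin_field M) (J : endo_field M) : Prop :=
  [/\ riemannian_metric g, almost_complex J & invariant_form J g].

Definition fundamental_form (R : realType) (n : nat) (M : manifold R n)
    (g : bilin_field M) (J : endo_field M) : bilin_field M :=
  fun c p u v => g c p (J c p u) v.

(* (d om)(u, v, w) for the constant coordinate fields u, v, w of the chart c,
   whose Lie brackets vanish. *)
Definition ext_d (R : realType) (n : nat) (M : manifold R n)
    (om : bilin_field M) (c : chart R M n) (x u v w : 'rV[R]_n) : R :=
  'D_u (fun y => om c (chart_inv c y) v w) x
  + 'D_v (fun y => om c (chart_inv c y) w u) x
  + 'D_w (fun y => om c (chart_inv c y) u v) x.

Definition closed_form (R : realType) (n : nat) (M : manifold R n)
    (om : bilin_field M) : Prop :=
  forall c x, atlas c -> chart_cod c x -> forall u v w, ext_d om c x u v w = 0.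

(* Multiplication by i on C^m = R^m + i R^m. *)
Definition J_std (R : realType) (m : nat) (v : 'rV[R]_(m + m)) :
    'rV[R]_(m + m) :=
  row_mx (- rsubmx v) (lsubmx v).

(* J comes from a complex structure: there are local holomorphic coordinates
   around every point.  (No appeal is made to the Nijenhuis tensor.) *)
Definition integrable_acs (R : realType) (m : nat) (M : manifold R (m + m))
    (J : endo_field M) : Prop :=
  forall p : M, exists z : chart R M (m + m),
    [/\ atlas z, chart_dom z p &
        forall q, chart_dom z q -> forall v, J z q v = J_std v].

Definition almost_kahler (R : realType) (n : nat) (M : manifold R n)
    (g : bilin_field M) (J : endo_field M) : Prop :=
  almost_hermitian g J /\ closed_form (fundamental_form g J).

Definition kahler (R : realType) (m : nat) (M : manifold R (m + m))
    (g : bilin_field M) (J : endo_field M) : Prop :=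
  almost_kahler g J /\ integrable_acs J.

Definition strictly_almost_kahler (R : realType) (m : nat)
    (M : manifold R (m + m)) (g : bilin_field M) (J : endo_field M) : Prop :=
  almost_kahler g J /\ ~ integrable_acs J.

Definition form_metric (R : realType) (n : nat) (M : manifold R n)
    (om : bilin_field M) (J : endo_field M) : bilin_field M :=
  fun c p u v => om c p u (J c p v).

Definition form_compatible (R : realType) (n : nat) (M : manifold R n)
    (om : bilin_field M) (J : endo_field M) : Prop :=
  riemannian_metric (form_metric om J) /\ invariant_form J (form_metric om J).

Definition smooth_compact_deformation (R : realType) (n : nat)
    (M : manifold R n) (J0 : endo_field M) (J : R -> endo_field M) : Prop :=
  exists a b : R,
    [/\ a < 0 < b,
        forall t, a < t < b -> almost_complex (J t),
        forall c, atlas c -> forall v,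
          smooth_on [set tx : R * 'rV[R]_n | a < tx.1 < b /\ chart_cod c tx.2]
            (fun tx => J tx.1 c (chart_inv c tx.2) v),
        forall c p, atlas c -> chart_dom c p -> J 0 c p = J0 c p
      & exists2 K : set M, compact K &
          forall t c p, a < t < b -> atlas c -> chart_dom c p -> ~ K p ->
            J t c p = J0 c p].

(* Main.v *)
From HB Require Import structures.
Require Import Defs.
From mathcomp Require Import all_boot all_order all_algebra.
From mathcomp Require Import all_classical all_reals all_analysis.
From mathcomp Require Import ring lra.
Set Implicit Arguments.
Unset Strict Implicit.
Unset Printing Implicit Defensive.
Import Order.TTheory GRing.Theory Num.Theory.
Import numFieldNormedType.Exports.
Local Open Scope classical_set_scope.
Local Open Scope ring_scope.

(** The idea is to conjugate [J0] by a family of symplectic transvections.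
    Write [om] for the Kaehler form.  For a vector [X] and a number [s] the map
    [v |-> v + s om(v, X) X] preserves [om], because [om(X, X) = 0], and its
    inverse is the same map with [- s].  Hence the conjugate of [J0] by such a
    map is again an [om]-compatible complex structure, for every [s].  Letting [s = t h] for a compactly supported function [h],
    and [X] a vector field defined near the support of [h], gives a smooth
    compactly supported deformation [J_t], [twisted] below, which is
    [om]-compatible for every [t]; the fundamental form of its metric is [om],
    which is closed.

    It remains to choose [h] and [X] so that [J_t] is not integrable.  Take
    holomorphic coordinates [z] of [J0] around a point [q], so that [J0] is the
    constant matrix [J] there; let [X] be the constant field [a] in these
    coordinates and let [h] vanish at [q] with a differential that kills [a],
    [J a] and [J u] but not [u].  In complex dimension at least 2 the coordinate
    vectors [a = e_0], [u = e_1] and [h] a bump times the coordinate along [e_1]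
    do the job.  Suppose that [J_t] had holomorphic coordinates [w] at [q], and
    let [phi] be the transition map from [z] to [w].  The generalised
    Cauchy-Riemann equations read
      [D phi (J v) + h P_v = J (D phi v)]
    with [P_v] smooth.  Differentiating once at [q], where [h = 0], gives
      [B(d, J v) + dh(d) P_v = J B(d, v)],
    where [B] is the second differential of [phi], a symmetric form.  For the
    directions [d] killed by [dh] this says that [B(d, .)] is complex linear, and
    symmetry then propagates this to [B(u, J a) = J B(u, a)]
    ([symmetric_complex_linear]), so [dh(u) P_a = 0] at [q]
    ([cauchy_riemann_obstruction]).  But [P_a = t g0(a, a) D phi a] at [q], and
    [D phi] is injective: a contradiction for every nonzero [t].

    The analysis behind this consists of the symmetry of second derivatives
    ([derive_sym]), a smooth bump function ([bump_exists]) and the stability of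
    [Ck_on] under sums, products and composition. *)

(** * Stability properties of C^k maps *)

Section CkCalculus.
Context {R : realType}.
Implicit Types V W : normedModType R.

(** Being differentiable is a local property: the differential of [f] also
    serves as a first order expansion of [g]. *)
Lemma near_eq_differentiable V W (f g : V -> W) (x : V) :
  {near x, f =1 g} -> differentiable f x -> differentiable g x.
Proof.
move=> fg df.
have fgx : f x = g x by exact: nbhs_singleton fg.
have fg0 : \forall h \near (0 : V), f (h + x) = g (h + x).
  by move/nbhs0P : fg; apply: filterS => h; rewrite addrC.
have [dcont dexp] := (diff_locallyP x f).1 df.
have gexp : g \o shift x = cst (g x) + 'd f x +o_ 0 id.
  apply/eqaddoP => e e0.
  move/eqaddoP : dexp => /(_ e e0).
  apply: filterS2 fg0 => h E; rewrite !fctE /=.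
  by rewrite -fgx -E.
have dg : 'd g x = 'd f x :> (V -> W) by apply: diff_unique.
by apply/diff_locallyP; rewrite dg.
Qed.

Lemma Ck_on_subset V W (U U' : set V) k (f : V -> W) :
  U `<=` U' -> Ck_on U' k f -> Ck_on U k f.
Proof.
move=> sub; elim: k f => [|k IH] f /=; first by move=> h x /sub/h.
by move=> [df Df]; split=> [x /sub/df //|v]; apply: IH.
Qed.

(** All the derivatives in [Ck_on] are total functions, so local statements glue
    without any choice. *)
Lemma Ck_on_local V W (U : set V) k (f : V -> W) :
  (forall x, U x -> exists2 U' : set V, U' x & Ck_on U' k f) -> Ck_on U k f.
Proof.
elim: k f => [|k IH] f /= loc.
  by move=> x /loc [U' U'x]; apply.
split=> [x /loc [U' U'x [df _]]|v]; first exact: df.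
by apply: IH => x /loc [U' U'x [_ Df]]; exists U'.
Qed.

(** Openness of [U] makes the derivatives of two maps that agree on [U] agree
    on [U] as well. *)
Lemma Ck_on_eq V W (U : set V) k (f g : V -> W) : open U ->
  (forall x, U x -> f x = g x) -> Ck_on U k f -> Ck_on U k g.
Proof.
move=> oU; elim: k f g => [|k IH] f g fg /=.
  move=> cf x Ux; have := cf x Ux; rewrite /prop_for /continuous_at => h.
  rewrite -(fg _ Ux); apply: cvg_trans h; apply: near_eq_cvg.
  by near do apply: fg; exact: open_nbhs_nbhs.
have fgnear x : U x -> {near x, f =1 g}.
  by move=> Ux; apply: filterS fg _; exact: open_nbhs_nbhs.
move=> [df Df]; split=> [x Ux|v].
  by apply: near_eq_differentiable (fgnear _ Ux) (df _ Ux).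
apply: IH (Df v) => x Ux; apply: near_eq_derive.
exact: fgnear.
Unshelve. all: by end_near. Qed.

Lemma Ck_onW V W (U : set V) k (f : V -> W) : Ck_on U k.+1 f -> Ck_on U k f.
Proof.
elim: k f => [|k IH] f.
  by move=> [df _] x Ux; exact/differentiable_continuous/df.
by move=> [df Df]; split=> // v; apply/IH/Df.
Qed.

Lemma Ck_on_cst V W (U : set V) k (w : W) : Ck_on U k (cst w).
Proof.
elim: k w => [|k IH] w /=; first by move=> x _; exact: cst_continuous.
split=> [x _|v]; first exact: differentiable_cst.
have -> : (fun x => 'D_v (cst w) x) = cst 0; last exact: IH.
by apply/funext => x; rewrite derive_cst.
Qed.

Lemma Ck_on_linear V W (U : set V) k (f : {linear V -> W}) :
  continuous f -> Ck_on U k f.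
Proof.
move=> cf; case: k => [|k] /=; first by move=> x _; exact: cf.
split=> [x _|v]; first exact: linear_differentiable.
have -> : (fun x => 'D_v f x) = cst (f v); last exact: Ck_on_cst.
apply/funext => x; rewrite deriveE; last exact: linear_differentiable.
by rewrite diff_lin.
Qed.

Lemma Ck_on_id V (U : set V) k : Ck_on U k (fun x : V => x).
Proof. by apply: (@Ck_on_linear _ _ _ _ idfun) => x; exact: cvg_id. Qed.

Lemma Ck_onD V W (U : set V) k (f g : V -> W) : open U ->
  Ck_on U k f -> Ck_on U k g -> Ck_on U k (fun x => f x + g x).
Proof.
move=> oU; elim: k f g => [|k IH] f g /=.
  by move=> cf cg x Ux; apply: continuousD; [exact: cf|exact: cg].
move=> [df Df] [dg Dg]; split=> [x Ux|v].
  by apply: differentiableD; [exact: df|exact: dg].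
apply: (@Ck_on_eq _ _ _ _ (fun x => 'D_v f x + 'D_v g x)) => //; last first.
  by apply: IH; [exact: Df|exact: Dg].
by move=> x Ux; rewrite -deriveD//; apply: diff_derivable; [exact: df|exact: dg].
Qed.

Lemma Ck_on_sum V W (U : set V) k n (F : 'I_n -> V -> W) : open U ->
  (forall i, Ck_on U k (F i)) -> Ck_on U k (fun x => \sum_(i < n) F i x).
Proof.
move=> oU; elim: n F => [|n IH] F CF.
  under eq_fun do rewrite big_ord0.
  exact: Ck_on_cst.
under eq_fun do rewrite big_ord_recl.
by apply: Ck_onD => //; apply: IH.
Qed.

Lemma Ck_onM V (U : set V) k (f g : V -> R) : open U ->
  Ck_on U k f -> Ck_on U k g -> Ck_on U k (fun x => f x * g x).
Proof.
move=> oU; elim: k f g => [|k IH] f g.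
  by move=> cf cg x Ux; apply: continuousM; [exact: cf|exact: cg].
move=> Cf Cg; have [df Df] := Cf; have [dg Dg] := Cg; split=> [x Ux|v].
  by apply: differentiableM; [exact: df|exact: dg].
apply: (@Ck_on_eq _ _ _ _ (fun x => f x * 'D_v g x + g x * 'D_v f x)) => //.
  move=> x Ux.
  by rewrite deriveM//; apply: diff_derivable; [exact: df|exact: dg].
by apply: Ck_onD => //; apply: IH; [exact: Ck_onW|exact: Dg|exact: Ck_onW|exact: Df].
Qed.

Lemma Ck_on_lin_comp V W W' (U : set V) k (L : {linear W -> W'}) (f : V -> W) :
  open U -> continuous L -> Ck_on U k f -> Ck_on U k (L \o f).
Proof.
move=> oU cL; elim: k f => [|k IH] f /=.
  by move=> cf x Ux; apply: continuous_comp; [exact: cf|exact: cL].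
move=> [df Df].
have dL y : differentiable L y by exact: linear_differentiable.
split=> [x Ux|v]; first by apply: differentiable_comp => //; exact: df.
apply: (@Ck_on_eq _ _ _ _ (L \o (fun x => 'D_v f x))) => //; last exact: IH.
move=> x /df dfx /=.
rewrite !deriveE//; last exact: differentiable_comp.
by rewrite [in RHS]diff_comp//= diff_lin.
Qed.

Lemma Ck_onZl V W (U : set V) k (f : V -> R) (w : W) : open U ->
  Ck_on U k f -> Ck_on U k (fun x => f x *: w).
Proof.
move=> oU Cf.
have lin : linear (fun c : R => c *: w).
  by move=> c a b; rewrite scalerDl scalerA.
pose HL := GRing.isLinear.Build _ _ _ _ _ lin.
pose L : {linear R -> W} := HB.pack (fun c : R => c *: w) HL.
by apply: (@Ck_on_lin_comp _ _ _ U k L f) => //; exact: scalel_continuous.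
Qed.

Lemma Ck_on_coord V n (U : set V) k (f : V -> 'rV[R]_n) j : open U ->
  Ck_on U k f -> Ck_on U k (fun x => f x 0 j).
Proof.
move=> oU Cf.
have lin : linear (fun v : 'rV[R]_n => v 0 j : R).
  by move=> c a b; rewrite !mxE.
pose HL := GRing.isLinear.Build _ _ _ _ _ lin.
pose L : {linear 'rV[R]_n -> R} := HB.pack (fun v : 'rV[R]_n => v 0 j : R) HL.
by apply: (@Ck_on_lin_comp _ _ _ U k L f) => //; exact: coord_continuous.
Qed.

(** A row vector is the sum of its coordinates times the basis vectors, so
    smoothness can be tested on coordinates. *)
Lemma Ck_on_rV V n (U : set V) k (f : V -> 'rV[R]_n) : open U ->
  (forall j, Ck_on U k (fun x => f x 0 j)) -> Ck_on U k f.
Proof.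
move=> oU Cf.
have -> : f = (fun x => \sum_j f x 0 j *: delta_mx 0 j).
  by apply/funext => y; rewrite -row_sum_delta.
by apply: Ck_on_sum => // j; exact: Ck_onZl.
Qed.

Lemma Ck_onZ V n (U : set V) k (f : V -> R) (g : V -> 'rV[R]_n) : open U ->
  Ck_on U k f -> Ck_on U k g -> Ck_on U k (fun x => f x *: g x).
Proof.
move=> oU Cf Cg; apply: Ck_on_rV => // j.
under eq_fun do rewrite mxE.
by apply: Ck_onM => //; exact: Ck_on_coord.
Qed.

Lemma deriveE_delta W n (f : 'rV[R]_n -> W) x v : differentiable f x ->
  'D_v f x = \sum_j v 0 j *: 'D_(delta_mx 0 j) f x.
Proof.
move=> df; rewrite deriveE// {1}[v]row_sum_delta linear_sum.
by apply: eq_bigr => j _; rewrite linearZ deriveE.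
Qed.

(** By the chain rule the derivative of the composite is a finite sum of
    products of maps of class [C^k] and composites of maps of class [C^k]; this
    is where the finite dimension of the intermediate space enters. *)
Lemma Ck_on_comp V n (U : set V) (U' : set 'rV[R]_n) k
    (f : 'rV[R]_n -> R) (phi : V -> 'rV[R]_n) : open U ->
  (forall x, U x -> U' (phi x)) ->
  Ck_on U k phi -> Ck_on U' k f -> Ck_on U k (f \o phi).
Proof.
move=> oU UU'; elim: k f phi UU' => [|k IH] f phi UU'.
  by move=> cp cf x Ux; apply: continuous_comp; [exact: cp|exact/cf/UU'].
move=> Cp Cf; have [dp Dp] := Cp; have [df Df] := Cf.
split=> [x Ux|v].
  by apply: differentiable_comp; [exact: dp|exact/df/UU'].
apply: (@Ck_on_eq _ _ _ _ (fun x => \sum_j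
    ('D_v phi x) 0 j * ((fun y => 'D_(delta_mx 0 j) f y) \o phi) x)) => //.
  move=> x Ux.
  have dpx := dp _ Ux; have dfx := df _ (UU' _ Ux).
  rewrite [RHS]deriveE; last exact: differentiable_comp.
  by rewrite [in RHS]diff_comp//= -(deriveE v dpx) -(deriveE _ dfx) (deriveE_delta _ dfx).
apply: Ck_on_sum => // j; apply: Ck_onM => //.
  by apply: Ck_on_coord => //; exact: Dp.
by apply: IH => //; [exact: Ck_onW|exact: Df].
Qed.

Lemma Ck_on_comp_rV V n p (U : set V) (U' : set 'rV[R]_n) k
    (f : 'rV[R]_n -> 'rV[R]_p) (phi : V -> 'rV[R]_n) : open U -> open U' ->
  (forall x, U x -> U' (phi x)) ->
  Ck_on U k phi -> Ck_on U' k f -> Ck_on U k (f \o phi).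
Proof.
move=> oU oU' UU' Cp Cf; apply: Ck_on_rV => // j.
have Cfj := Ck_on_coord j oU' Cf.
exact: (Ck_on_comp oU UU' Cp Cfj).
Qed.

End CkCalculus.

(** * Symmetry of second derivatives *)

Lemma is_derive_line {R : realType} (V W : normedModType R) (f : V -> W)
    (u p : V) (r : R) : differentiable f (r *: u + p) ->
  is_derive r 1 (fun h : R => f (h *: u + p)) ('D_u f (r *: u + p)).
Proof.
move=> df.
have dl : is_diff r (fun h : R => h *: u + p) ( *:%R^~ u).
  have -> : (fun h : R => h *: u + p) = *:%R^~ u + cst p by [].
  apply: is_diff_eq (is_diffD (is_diff_scalel r u) (is_diff_cst p r)) _.
  exact: addr0.
have dfl : differentiable (f \o (fun h : R => h *: u + p)) r.
  by apply: differentiable_comp.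
apply: DeriveDef; first exact: diff_derivable.
rewrite deriveE// diff_comp//= diff_val scale1r.
by rewrite deriveE.
Qed.

Lemma mean_value_line {R : realType} (V : normedModType R) (f : V -> R)
    (u p : V) (s : R) : 0 < s ->
  (forall r, 0 <= r <= s -> differentiable f (r *: u + p)) ->
  exists2 r, 0 <= r <= s & f (s *: u + p) - f p = s * 'D_u f (r *: u + p).
Proof.
move=> s0 df.
have dr r : 0 <= r <= s ->
    is_derive r 1 (fun h : R => f (h *: u + p)) ('D_u f (r *: u + p)).
  by move=> /df /is_derive_line.
have [||r] := @MVT R (fun h : R => f (h *: u + p)) (fun h => 'D_u f (h *: u + p)) 0 s s0.
- by move=> x; rewrite in_itv /= => /andP[/ltW x0 /ltW xs]; apply: dr; rewrite x0.
- apply: derivable_within_continuous => x; rewrite in_itv /= => xs.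
  by have [] := dr _ xs.
rewrite in_itv /= => /andP[/ltW r0 /ltW rs]; rewrite scale0r add0r subr0 mulrC => E.
by exists r; rewrite ?r0.
Qed.

(** Two applications of the mean value theorem express the symmetric second
    difference of [f] by the iterated derivative taken in the order [u], [v]; the
    other order is obtained by exchanging the two vectors. *)
Lemma second_difference {R : realType} (V : normedModType R) (U : set V)
    (f : V -> R) (u v p : V) (s : R) : 0 < s -> Ck_on U 2 f ->
  (forall a b : R, 0 <= a <= s -> 0 <= b <= s -> U (a *: u + (b *: v + p))) ->
  exists a b : R, [/\ 0 <= a <= s, 0 <= b <= s &
    f (s *: u + (s *: v + p)) - f (s *: u + p) - f (s *: v + p) + f p
    = s * (s * 'D_v ('D_u f) (a *: u + (b *: v + p)))].
Proof.
move=> s0 [df Df] box.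
have ss : 0 <= s <= s by apply/andP; split => //; exact: ltW.
have s00 : 0 <= (0:R) <= s by apply/andP; split => //; exact: ltW.
have df0 a : 0 <= a <= s -> differentiable f (a *: u + p).
  by move=> /box /(_ s00); rewrite scale0r add0r => /df.
have df1 a : 0 <= a <= s -> differentiable f (s *: v + (a *: u + p)).
  by move=> /box /(_ ss); rewrite addrCA => /df.
(* The increment of [f] along [s v], to which the mean value theorem is applied
   along [u] first. *)
pose g y := f (s *: v + y) - f y.
have shiftd y : differentiable f (s *: v + y) ->
    is_diff y (fun y => f (s *: v + y)) ('d f (s *: v + y)).
  move=> dfy.
  have dsh : is_diff y (fun y => s *: v + y) id.
    have -> : (fun y => s *: v + y) = cst (s *: v) + id by [].
    apply: is_diff_eq (is_diffD (is_diff_cst (s *: v) y) (is_diff_id y)) _.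
    exact: add0r.
  have /differentiableP dfy' := dfy.
  by apply: (@is_diff_comp _ _ _ _ (fun y => s *: v + y) id f).
have dg a : 0 <= a <= s -> differentiable g (a *: u + p).
  move=> as_; apply: differentiableB; last exact: df0.
  by have [] := shiftd _ (df1 _ as_).
have [a as_ Ea] := mean_value_line s0 dg.
have [|b bs Eb] := @mean_value_line _ _ ('D_u f) v (a *: u + p) s s0.
  by move=> r rs; apply: (Df u).1; rewrite addrCA; exact: box.
exists a, b; split => //.
have Dg : 'D_u g (a *: u + p) =
    'D_u f (s *: v + (a *: u + p)) - 'D_u f (a *: u + p).
  have dfa := df0 _ as_; have dfsa := df1 _ as_.
  have [dfs Efs] := shiftd _ dfsa.
  rewrite /g (_ : (fun y => _) = (fun y => f (s *: v + y)) - f)//.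
  rewrite deriveB; [|exact: diff_derivable..].
  by rewrite (deriveE _ dfs) (deriveE _ dfa) (deriveE _ dfsa) Efs.
rewrite (addrCA (a *: u)) -Eb -Dg -Ea /g (addrCA (s *: u)) opprB.
by rewrite -[LHS]addrA [- f (s *: v + p) + _]addrC.
Qed.

Lemma continuous_eq_approx {R : realType} (V : normedModType R) (F G : V -> R)
    (p : V) : {for p, continuous F} -> {for p, continuous G} ->
  (forall d : R, 0 < d -> exists y y', [/\ ball p d y, ball p d y' & F y = G y']) ->
  F p = G p.
Proof.
move=> cF cG H; apply/eqP; apply: contraT => neq.
pose e := `|F p - G p| / 2.
have e0 : 0 < e by rewrite divr_gt0// normr_gt0 subr_eq0.
have nF : \forall y \near p, `|F p - F y| < e.
  by move/cvgrPdist_lt : cF; exact.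
have nG : \forall y \near p, `|G p - G y| < e.
  by move/cvgrPdist_lt : cG; exact.
have /nbhs_ballP[d /= d0 bd] :
    nbhs p ([set y | `|F p - F y| < e] `&` [set y | `|G p - G y| < e]).
  by apply: filterI.
have [y [y' [/bd [H1 _] /bd [_ H2] E]]] := H _ d0.
have : `|F p - G p| < e + e.
  rewrite -(subrKA (F y)) (le_lt_trans (ler_normD _ _))// ltrD//.
  by rewrite distrC E.
by rewrite /e -splitr ltxx.
Qed.

(** Both iterated derivatives take, arbitrarily close to [p], a common value: the
    second difference of [f] divided by the square of the step.  By continuity
    they agree at [p]. *)
Lemma derive_sym {R : realType} (V : normedModType R) (U : set V)
    (f : V -> R) (u v p : V) : open U -> U p -> Ck_on U 2 f ->
  'D_u ('D_v f) p = 'D_v ('D_u f) p.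
Proof.
move=> oU Up Cf.
apply: (@continuous_eq_approx _ _ ('D_u ('D_v f)) ('D_v ('D_u f)) p) => [||d d0].
- exact: ((Cf.2 v).2 u p Up).
- exact: ((Cf.2 u).2 v p Up).
have /nbhs_ballP[r /= r0 br] : nbhs p U by exact: open_nbhs_nbhs.
(* The summand 1 makes [N] positive and keeps the points [a u + b v + p] strictly
   inside the ball. *)
pose N := `|u| + `|v| + 1.
have N0 : 0 < N by rewrite ltr_wpDl// addr_ge0.
pose s := Num.min d r / N.
have dr0 : 0 < Num.min d r by rewrite lt_min d0.
have s0 : 0 < s by rewrite divr_gt0.
have box (a b : R) : 0 <= a <= s -> 0 <= b <= s ->
    ball p (Num.min d r) (a *: u + (b *: v + p)).
  move=> /andP[a0 as_] /andP[b0 bs].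
  rewrite -ball_normE /= addrA opprD addrCA subrr addr0.
  rewrite normrN (le_lt_trans (ler_normD _ _))// !normrZ !ger0_norm//.
  apply: (@le_lt_trans _ _ (s * (`|u| + `|v|))).
    by rewrite mulrDr lerD// ler_wpM2r.
  by rewrite /s mulrAC ltr_pdivrMr// ltr_pM2l// /N ltrDl.
have boxd (a b : R) : 0 <= a <= s -> 0 <= b <= s ->
    ball p d (a *: u + (b *: v + p)).
  by move=> as_ bs; apply: le_ball (box _ _ as_ bs); rewrite ge_min lexx.
have boxU (a b : R) : 0 <= a <= s -> 0 <= b <= s ->
    U (a *: u + (b *: v + p)).
  move=> as_ bs; apply: br; apply: le_ball (box _ _ as_ bs).
  by rewrite ge_min lexx orbT.
have [a [b [as_ bs E1]]] := second_difference s0 Cf boxU.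
have boxU' (c e : R) : 0 <= c <= s -> 0 <= e <= s ->
    U (c *: v + (e *: u + p)).
  by move=> bs' as_'; rewrite addrCA; exact: boxU.
have [b' [a' [bs' as_' E2]]] := second_difference s0 Cf boxU'.
exists (b' *: v + (a' *: u + p)), (a *: u + (b *: v + p)); split.
- by rewrite addrCA; exact: boxd.
- exact: boxd.
have sn0 : s != 0 by rewrite gt_eqF.
apply: (mulfI sn0); apply: (mulfI sn0).
apply: etrans (etrans (esym E2) _) E1.
by rewrite (addrCA (s *: v)) (addrAC (f _)).
Qed.

(** * A smooth bump function *)

(** The functions [exp(- 1 / s) / s ^ k], extended by 0 to [s <= 0].  The whole
    family is considered because the derivative of each member is a combination
    of two others ([is_derive_flat]), which yields smoothness by induction. *)
Definition flat {R : realType} (k : nat) (s : R) : R :=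
  if 0 < s then s^-1 ^+ k * expR (- s^-1) else 0.

(** The exponential series gives [y ^ (k + 2) <= (k + 2)! exp y] for
    [y = 1 / s].  A quadratic bound is what makes the derivative at 0 vanish. *)
Lemma flat_quadratic {R : realType} k (s : R) :
  `|flat k s| <= k.+2`!%:R * s ^+ 2.
Proof.
rewrite /flat; case: ifPn => [s0|_]; last first.
  by rewrite normr0 mulr_ge0// ?sqr_ge0.
have i0 : 0 < s^-1 by rewrite invr_gt0.
rewrite ger0_norm; last by rewrite mulr_ge0 ?expR_ge0// exprn_ge0// ltW.
have h : s^-1 ^+ k.+2 <= k.+2`!%:R * expR s^-1.
  rewrite -ler_pdivrMl ?ltr0n ?fact_gt0// mulrC.
  by apply: le_trans (expR_ge1Dxn k.+1 (ltW i0)); rewrite lerDr.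
rewrite expRN ler_pdivrMr ?expR_gt0// -mulrA (mulrC (s ^+ 2)) mulrA.
rewrite -ler_pdivrMr ?exprn_gt0//; apply: le_trans h.
by rewrite -exprVn -exprD addn2.
Qed.

Lemma is_derive_flat {R : realType} k (s : R) :
  is_derive s 1 (flat k) (flat k.+2 s - k%:R * flat k.+1 s).
Proof.
have [s0|s0|->] := ltgtP s 0.
- have flat0 l : flat l s = 0 by rewrite /flat ltNge (ltW s0).
  rewrite !flat0 mulr0 subr0.
  have E : \forall x \near s, cst (0 : R) x = flat k x.
    near=> x; rewrite /flat ltNge ifF//.
    by apply/negbF/ltW; near: x; exact: lt_nbhsl.
  exact: near_eq_is_derive E (is_derive_cst (0 : R) s 1).
- have sn0 : s != 0 by rewrite gt_eqF.
  have E : \forall x \near s, x^-1 ^+ k * expR (- x^-1) = flat k x.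
    by near=> x; rewrite /flat ifT//; near: x; exact: lt_nbhsr.
  apply: near_eq_is_derive E _.
  have dinv : is_derive s 1 (fun x : R => x^-1) (- s ^- 2).
    have := is_deriveV sn0 (is_derive_id s 1).
    by rewrite /GRing.scale/= mulr1.
  have dexp : is_derive s 1 (fun x : R => expR (- x^-1)) (s ^- 2 * expR (- s^-1)).
    have dN := is_deriveN dinv.
    have := @is_derive1_comp R expR (- (fun x : R => x^-1)) s _ _ (is_derive_expR _) dN.
    by rewrite opprK mulrC.
  have dX := is_deriveX k dinv.
  have -> : flat k.+2 s - k%:R * flat k.+1 s =
      s^-1 ^+ k * (s ^- 2 * expR (- s^-1)) +
      expR (- s^-1) * ((k%:R * s^-1 ^+ k.-1) * - s ^- 2).
    rewrite /flat s0 -!exprVn.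
    by case: (k) => [|l] /=; rewrite ?(exprS _ l) !exprS; ring.
  have -> : (fun x : R => x^-1 ^+ k * expR (- x^-1)) =
      ((fun x => x^-1) ^+ k : R -> R) * (fun x : R => expR (- x^-1)).
    by apply/funext => x; rewrite /GRing.mul/= exprfctE.
  have := is_deriveM dX dexp.
  by rewrite exprfctE.
- have flat0 l : flat l (0 : R) = 0 by rewrite /flat ltxx.
  rewrite !flat0 mulr0 subr0.
  have C0 : 0 < k.+2`!%:R :> R by rewrite ltr0n fact_gt0.
  have cv : (fun h : R => h^-1 *:
      ((flat k \o shift 0) (h *: 1) - flat k 0)) @ 0^' --> (0 : R).
    apply/cvgrPdist_le => e e0; near=> h.
    have h0 : h != 0 by near: h; exact: nbhs_dnbhs_neq.
    rewrite sub0r normrN /= addr0 flat0 subr0 [h *: 1]mulr1.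
    rewrite normrZ normfV ler_pdivrMl ?normr_gt0//.
    apply: le_trans (flat_quadratic k h) _.
    rewrite -real_normK ?num_real// expr2 mulrCA ler_pM2l ?normr_gt0//.
    rewrite -ler_pdivlMl// mulrC; near: h.
    by apply: dnbhs0_le; rewrite divr_gt0.
  by apply: DeriveDef; [apply/cvg_ex; exists 0|exact/cvg_lim].
Unshelve. all: by end_near. Qed.

(** The statement for composites avoids a separate chain rule for functions on
    the line, and the induction needs it for all [k] at once. *)
Lemma Ck_on_flat {R : realType} (V : normedModType R) (U : set V) j k
    (g : V -> R) : open U -> Ck_on U j g -> Ck_on U j (flat k \o g).
Proof.
move=> oU.
have dflat l s : differentiable (flat l : R -> R) s.
  by apply/derivable1_diffP; have [] := is_derive_flat l s.
elim: j k g => [|j IH] k g.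
  move=> cg x Ux; apply: continuous_comp; first exact: cg.
  exact: differentiable_continuous.
move=> Cg; have [dg Dg] := Cg; split=> [x Ux|v].
  by apply: differentiable_comp => //; exact: dg.
apply: (@Ck_on_eq _ _ _ _ _
  (fun x => ((flat k.+2 \o g) x + - k%:R * (flat k.+1 \o g) x) * 'D_v g x)) => //.
  move=> x Ux; have dgx := dg _ Ux.
  rewrite [RHS]deriveE; last exact: differentiable_comp.
  rewrite [in RHS]diff_comp//= -(deriveE _ dgx).
  have [df Df] := is_derive_flat k (g x).
  rewrite -[X in 'd _ _ X]mulr1 -[_ * 1]/(_ *: 1) linearZ/=.
  by rewrite -(deriveE _ (dflat k (g x))) Df mulrC mulNr.
apply: Ck_onM => //; last exact: Dg.
apply: Ck_onD => //; first by apply: IH; exact: Ck_onW.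
apply: Ck_onM => //; first exact: Ck_on_cst.
by apply: IH; exact: Ck_onW.
Qed.

(** The function [flat 0] of [e ^ 2] minus the squared Euclidean distance to
    [x0]; the norm of row vectors being the maximum norm, it is at most the
    Euclidean one. *)
Lemma bump_exists {R : realType} n (x0 : 'rV[R]_n) (e : R) : 0 < e ->
  exists b : 'rV[R]_n -> R, [/\ smooth_on setT b, 0 < b x0 &
    forall y, b y != 0 -> `|x0 - y| < e].
Proof.
move=> e0.
exists (flat 0 \o (fun y =>
  e ^+ 2 + - 1 * \sum_i (y 0 i + - x0 0 i) * (y 0 i + - x0 0 i))).
split.
- move=> k; apply: Ck_on_flat; first exact: openT.
  apply: Ck_onD; [exact: openT|exact: Ck_on_cst|].
  apply: Ck_onM; [exact: openT|exact: Ck_on_cst|].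
  have C i : Ck_on [set: 'rV[R]_n] k (fun y => y 0 i + - x0 0 i).
    apply: Ck_onD; [exact: openT| |exact: Ck_on_cst].
    apply: Ck_on_coord; first exact: openT.
    exact: Ck_on_id.
  by apply: Ck_on_sum => [|i]; [exact: openT|apply: Ck_onM; first exact: openT].
- rewrite /= big1 ?mulr0 ?addr0; last by move=> i _; rewrite subrr mulr0.
  by rewrite /flat exprn_gt0// mulr_gt0// ?expR_gt0// exprn_gt0// invr_gt0 exprn_gt0.
- move=> y; rewrite /= /flat; case: ifPn; last by rewrite eqxx.
  rewrite mulN1r subr_gt0 => lt_e _.
  rewrite [ltLHS]/Num.Def.normr/= mx_normrE; apply/bigmax_ltP; split => //= -[i j] _ /=.
  rewrite (ord1 i) !mxE distrC -ltr_sqr ?nnegrE ?normr_ge0 ?ltW//.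
  rewrite real_normK ?num_real//; apply: le_lt_trans lt_e.
  rewrite (bigD1 j)//= expr2 lerDl sumr_ge0// => l _.
  by rewrite -expr2 sqr_ge0.
Qed.

(** * Symplectic transvections *)

Definition transvection {R : realType} {V : lmodType R} (w : V -> V -> R)
    (s : R) (X v : V) : V :=
  v + (s * w v X) *: X.

(** The conjugate of [J] by a transvection, since the transvection of parameter
    [- s] is the inverse of the one of parameter [s]. *)
Definition twist {R : realType} {V : lmodType R} (w : V -> V -> R)
    (J : V -> V) (s : R) (X v : V) : V :=
  transvection w (- s) X (J (transvection w s X v)).

Lemma twist0 {R : realType} {V : lmodType R} (w : V -> V -> R) J X (v : V) :
  twist w J 0 X v = J v.
Proof. by rewrite /twist /transvection oppr0 !mul0r !scale0r !addr0. Qed.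

Lemma twist_natural {R : realType} {V W : lmodType R} (L : {linear V -> W})
    (w : V -> V -> R) (w' : W -> W -> R) (J : V -> V) (J' : W -> W) s X v :
  (forall x y, w x y = w' (L x) (L y)) -> (forall x, L (J x) = J' (L x)) ->
  L (twist w J s X v) = twist w' J' s (L X) (L v).
Proof.
move=> ww' LJ.
have LT r x : L (transvection w r X x) = transvection w' r (L X) (L x).
  by rewrite /transvection linearD linearZ /= ww'.
by rewrite /twist LT LJ LT.
Qed.

Section Transvection.
Context {R : realType} {V : lmodType R} (w : V -> V -> R) (J : V -> V).
Context (w_lin : (forall u, scalar (w u)) /\ (forall v, scalar (fun u => w u v))).
Context (w_alt : forall v, w v v = 0).
Context (J_lin : linear J) (JJ : forall v, J (J v) = - v).
Context (w_J : forall u v, w (J u) (J v) = w u v).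

Let wDZl a u v x : w (u + a *: v) x = w u x + a * w v x.
Proof. by rewrite addrC w_lin.2 addrC. Qed.

Let wDZr a u v x : w x (u + a *: v) = w x u + a * w x v.
Proof. by rewrite addrC w_lin.1 addrC. Qed.

Lemma alternating_skew u v : w u v = - w v u.
Proof.
have := w_alt (u + 1 *: v).
by rewrite wDZl !wDZr !w_alt => E; apply/eqP; rewrite -addr_eq0; apply/eqP; lra.
Qed.

Lemma transvection_linear s X : linear (transvection w s X).
Proof.
move=> a u v; rewrite /transvection w_lin.2 scalerDr addrACA; congr (_ + _).
by rewrite scalerA -scalerDl mulrDr mulrCA.
Qed.

Lemma transvectionK s X : cancel (transvection w s X) (transvection w (- s) X).
Proof.
move=> v; rewrite /transvection wDZl w_alt mulr0 addr0 -addrA -scalerDl.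
by rewrite mulNr subrr scale0r addr0.
Qed.

Lemma transvection_symplectic s X u v :
  w (transvection w s X u) (transvection w s X v) = w u v.
Proof.
rewrite /transvection wDZl !wDZr w_alt (alternating_skew X v); ring.
Qed.

Lemma twist_linear s X : linear (twist w J s X).
Proof. by move=> a u v; rewrite /twist transvection_linear J_lin transvection_linear. Qed.

Lemma twistK s X v : twist w J s X (twist w J s X v) = - v.
Proof.
rewrite /twist -{2}(opprK s) transvectionK JJ.
have -> : - transvection w s X v = transvection w s X (- v).
  have wN : w (- v) X = - w v X.
    have := wDZl (-1) v v X; rewrite scaleN1r subrr => w0.
    by have := wDZl (-1) 0 v X; rewrite scaleN1r add0r w0 => ->; ring.
  by rewrite /transvection wN mulrN scaleNr opprD.
exact: transvectionK.
Qed.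

Lemma twist_symplectic s X u v : w (twist w J s X u) (twist w J s X v) = w u v.
Proof. by rewrite /twist transvection_symplectic w_J transvection_symplectic. Qed.

(** The transvection is an isometry from the twisted metric to the metric of
    [J], whence the symmetry and positivity of the former. *)
Lemma twist_metric s X u v : w u (twist w J s X v) =
  w (transvection w s X u) (J (transvection w s X v)).
Proof.
by rewrite /twist -{1}(transvectionK s X u) transvection_symplectic.
Qed.

(** The deviation from [J] is [s] times a combination of [X] and [J X]: this
    isolates the factor that vanishes where the cutoff does. *)
Lemma twist_expand s X v : twist w J s X v =
  J v + s *: (w v X *: J X + (- w (J v) X - s * w v X * w (J X) X) *: X).
Proof.
have JD u a x : J (u + a *: x) = J u + a *: J x by rewrite addrC J_lin addrC.
rewrite /twist /transvection JD wDZl -addrA; congr (_ + _).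
rewrite scalerDr !scalerA; congr (_ + _); congr (_ *: _); ring.
Qed.

End Transvection.

(** * Charts, transition maps and tensor fields *)

Lemma derive_lin_comp {R : realType} (V W W' : normedModType R)
    (L : {linear W -> W'}) (f : V -> W) x v : continuous L ->
  differentiable f x -> 'D_v (L \o f) x = L ('D_v f x).
Proof.
move=> cL dfx; have dL y : differentiable L y by exact: linear_differentiable.
rewrite (deriveE _ dfx) deriveE; last exact: differentiable_comp.
by rewrite diff_comp//= diff_lin.
Qed.

Lemma linear_rV_continuous {R : realType} n (W : normedModType R)
  (L : {linear 'rV[R]_n -> W}) : continuous L.
Proof.
have -> : (L : 'rV[R]_n -> W) = (fun x => \sum_j x 0 j *: L (delta_mx 0 j)).
  apply/funext => x; rewrite {1}[x]row_sum_delta linear_sum.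
  by apply: eq_bigr => j _; rewrite linearZ.
have C : Ck_on setT 0 (fun x : 'rV[R]_n => \sum_j x 0 j *: L (delta_mx 0 j)).
  apply: Ck_on_sum; first exact: openT.
  move=> j; apply: Ck_onZl; first exact: openT.
  apply: Ck_on_coord; first exact: openT.
  exact: Ck_on_id.
by move=> x; apply: C.
Qed.

Lemma open_preimage_on {T S : topologicalType} (f : T -> S) (U : set T)
    (A : set S) : open U -> open A -> (forall x, U x -> {for x, continuous f}) ->
  open (U `&` f @^-1` A).
Proof.
move=> oU oA cf; rewrite openE => x [Ux Ax]; apply: filterI.
  by apply: open_nbhs_nbhs.
by apply: (cf _ Ux); exact: open_nbhs_nbhs.
Qed.

Section Charts.
Context {R : realType} {n : nat} {M : manifold R n}.
Implicit Types (c d e : chart R M n) (p : M).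

Lemma chart_cod_map c p : chart_dom c p -> chart_cod c (chart_map c p).
Proof. by move=> cp; exists p. Qed.

Lemma chart_inv_dom c x : chart_cod c x -> chart_dom c (chart_inv c x).
Proof. by move=> [p cp <-]; rewrite chart_mapK. Qed.

Lemma chart_invK c x : chart_cod c x -> chart_map c (chart_inv c x) = x.
Proof. by move=> [p cp <-]; rewrite chart_mapK. Qed.

Lemma open_chart_image c (A : set M) : open A ->
  open (chart_map c @` (chart_dom c `&` A)).
Proof.
move=> oA.
have -> : chart_map c @` (chart_dom c `&` A) = chart_cod c `&` chart_inv c @^-1` A.
  apply/seteqP; split=> [x [p [cp Ap] <-]|x [cx Ax]].
    by split; [exact: chart_cod_map|rewrite /preimage /= chart_mapK].
  by exists (chart_inv c x); [split=> //; exact: chart_inv_dom|exact: chart_invK].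
by apply: open_preimage_on => //; [exact: chart_cod_open|exact: chart_inv_cont].
Qed.

Lemma chart_imageP c (A : set M) x : (chart_map c @` (chart_dom c `&` A)) x ->
  [/\ chart_cod c x, chart_dom c (chart_inv c x), A (chart_inv c x) &
      chart_map c (chart_inv c x) = x].
Proof.
move=> [p [cp Ap] <-]; rewrite chart_mapK//; split=> //.
exact: chart_cod_map.
Qed.

Lemma transition_smooth c d : atlas c -> atlas d ->
  smooth_on (chart_map c @` (chart_dom c `&` chart_dom d)) (transition c d).
Proof. by move=> ac ad; have [] := atlas_compatible ac ad. Qed.

Lemma overlap_image c d p : chart_dom c p -> chart_dom d p ->
  (chart_map c @` (chart_dom c `&` chart_dom d)) (chart_map c p).
Proof. by move=> cp dp; exists p. Qed.

Lemma transition_differentiable c d p : atlas c -> atlas d ->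
  chart_dom c p -> chart_dom d p -> differentiable (transition c d) (chart_map c p).
Proof.
move=> ac ad cp dp.
by have [df _] := transition_smooth ac ad 1; apply/df/overlap_image.
Qed.

Lemma change_coord_derive c d p v : atlas c -> atlas d ->
  chart_dom c p -> chart_dom d p ->
  change_coord c d p v = 'D_v (transition c d) (chart_map c p).
Proof.
by move=> ac ad cp dp; rewrite deriveE//; exact: transition_differentiable.
Qed.

Lemma change_coord_id c p v : atlas c -> chart_dom c p -> change_coord c c p v = v.
Proof.
move=> ac cp; rewrite change_coord_derive//.
rewrite (@near_eq_derive _ _ _ _ id) ?derive_id//.
have oc := @chart_cod_open _ _ _ c.
have : nbhs (chart_map c p) (chart_cod c).
  by apply: open_nbhs_nbhs; split=> //; exact: chart_cod_map.
by apply: filterS => x cx; rewrite /transition /= chart_invK.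
Qed.

Lemma change_coord_comp c d e p v : atlas c -> atlas d -> atlas e ->
  chart_dom c p -> chart_dom d p -> chart_dom e p ->
  change_coord d e p (change_coord c d p v) = change_coord c e p v.
Proof.
move=> ac ad ae cp dp ep.
rewrite [RHS]change_coord_derive//.
have tp : transition c d (chart_map c p) = chart_map d p.
  by rewrite /transition /= chart_mapK.
have dcd := transition_differentiable ac ad cp dp.
have dde : differentiable (transition d e) (transition c d (chart_map c p)).
  by rewrite tp; exact: transition_differentiable.
rewrite (@near_eq_derive _ _ _ _ (transition d e \o transition c d)).
  rewrite deriveE; last exact: differentiable_comp.
  by rewrite (diff_comp dcd dde) /= tp.
have : nbhs (chart_map c p) (chart_map c @` (chart_dom c `&` chart_dom d)).
  apply: open_nbhs_nbhs; split; last exact: overlap_image.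
  by apply: open_chart_image; exact: chart_dom_open.
apply: filterS => x /chart_imageP[_ _ dx _].
by rewrite /transition /= chart_mapK.
Qed.

(** The field that is constantly [a] in the chart [z] reads in the chart [c] as a
    directional derivative of the transition map, composed with the inverse
    transition. *)
Lemma change_coord_smooth z c a : atlas z -> atlas c ->
  smooth_on (chart_map c @` (chart_dom c `&` chart_dom z))
    (fun x => change_coord z c (chart_inv c x) a).
Proof.
move=> az ac k.
have oc : open (chart_map c @` (chart_dom c `&` chart_dom z)).
  by apply: open_chart_image; exact: chart_dom_open.
have oz : open (chart_map z @` (chart_dom z `&` chart_dom c)).
  by apply: open_chart_image; exact: chart_dom_open.
apply: (@Ck_on_eq _ _ _ _ _ ((fun y => 'D_a (transition z c) y) \o transition c z)) => //.
  move=> x /chart_imageP[cx cix zix cxE] /=.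
  by rewrite [RHS]change_coord_derive.
apply: Ck_on_comp_rV (oz) _ (transition_smooth ac az k) _ => //.
  by move=> x /chart_imageP[cx cix zix cxE]; exact: overlap_image.
by have [_] := transition_smooth az ac k.+1; apply.
Qed.

(** The base point is allowed to depend smoothly on a parameter [x], so that the
    same lemma serves for fields in a chart ([psi] the identity) and for families
    depending on time ([psi] a projection). *)
Lemma smooth_endo_apply {V : normedModType R} (T : endo_field M) c
    (U : set V) (psi Y : V -> 'rV[R]_n) k :
  smooth_endo_field T -> atlas c -> open U ->
  (forall x, U x -> chart_cod c (psi x)) ->
  Ck_on U k psi -> Ck_on U k Y ->
  Ck_on U k (fun x => T c (chart_inv c (psi x)) (Y x)).
Proof.
move=> [Tlin _ Tsm] ac oU Upsi Cpsi CY.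
apply: (@Ck_on_eq _ _ _ _ _ (fun x => \sum_j (Y x) 0 j *:
   ((fun y => T c (chart_inv c y) (delta_mx 0 j)) \o psi) x)) => //.
  move=> x Ux /=; have l := Tlin _ _ ac (chart_inv_dom (Upsi _ Ux)).
  pose HL := GRing.isLinear.Build _ _ _ _ _ l.
  pose L : {linear 'rV[R]_n -> 'rV[R]_n} := HB.pack (T c (chart_inv c (psi x))) HL.
  rewrite -[RHS]/(L (Y x)) {2}[Y x]row_sum_delta linear_sum.
  by apply: eq_bigr => j _; rewrite linearZ.
apply: Ck_on_sum => // j; apply: Ck_onZ => //; first exact: Ck_on_coord.
by apply: Ck_on_comp_rV (@chart_cod_open _ _ _ c) Upsi Cpsi _ => //; exact: Tsm.
Qed.

Lemma smooth_bilin_apply {V : normedModType R} (b : bilin_field M) c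
    (U : set V) (psi Y Z : V -> 'rV[R]_n) k :
  smooth_bilin_field b -> atlas c -> open U ->
  (forall x, U x -> chart_cod c (psi x)) ->
  Ck_on U k psi -> Ck_on U k Y -> Ck_on U k Z ->
  Ck_on U k (fun x => b c (chart_inv c (psi x)) (Y x) (Z x)).
Proof.
move=> [blin _ bsm] ac oU Upsi Cpsi CY CZ.
apply: (@Ck_on_eq _ _ _ _ _ (fun x => \sum_i (Y x) 0 i * \sum_j ((Z x) 0 j *
   ((fun y => b c (chart_inv c y) (delta_mx 0 i) (delta_mx 0 j)) \o psi) x))) => //.
  move=> x Ux /=; have [l2 l1] := blin _ _ ac (chart_inv_dom (Upsi _ Ux)).
  pose HL1 z := GRing.isLinear.Build _ _ _ _ _ (l1 z).
  pose L1 z : {scalar 'rV[R]_n} := 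
    HB.pack (fun y => b c (chart_inv c (psi x)) y z) (HL1 z).
  pose HL2 y := GRing.isLinear.Build _ _ _ _ _ (l2 y).
  pose L2 y : {scalar 'rV[R]_n} := HB.pack (b c (chart_inv c (psi x)) y) (HL2 y).
  rewrite -[RHS]/(L1 (Z x) (Y x)) [in RHS](row_sum_delta (Y x)) linear_sum.
  apply: eq_bigr => i _; rewrite linearZ; congr (_ * _).
  rewrite -[RHS]/(L2 (delta_mx 0 i) (Z x)) [in RHS](row_sum_delta (Z x)) linear_sum.
  by apply: eq_bigr => j _; rewrite linearZ.
apply: Ck_on_sum => // i; apply: Ck_onM => //; first exact: Ck_on_coord.
apply: Ck_on_sum => // j; apply: Ck_onM => //; first exact: Ck_on_coord.
by apply: Ck_on_comp Upsi Cpsi _ => //; exact: bsm.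
Qed.

End Charts.

(** * The obstruction to holomorphic coordinates *)

Lemma derive_coord {R : realType} (V : normedModType R) n (f : V -> 'rV[R]_n) x v j :
  differentiable f x -> 'D_v f x 0 j = 'D_v (fun y => f y 0 j) x.
Proof.
by move=> df; rewrite derive_mx ?mxE//; exact: diff_derivable.
Qed.

Lemma derive_sym_rV {R : realType} (V : normedModType R) n (U : set V)
    (f : V -> 'rV[R]_n) (u v p : V) : open U -> U p -> Ck_on U 2 f ->
  'D_u ('D_v f) p = 'D_v ('D_u f) p.
Proof.
move=> oU Up Cf; apply/rowP => j.
have nU : nbhs p U by exact: open_nbhs_nbhs.
have E w w' : 'D_w ('D_w' f) p 0 j = 'D_w ('D_w' (fun y => f y 0 j)) p.
  rewrite derive_coord; last exact: ((Cf.2 w').1 p Up).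
  apply: near_eq_derive; apply: filterS nU => y Uy.
  by rewrite derive_coord//; exact: (Cf.1 y Uy).
have Cj := Ck_on_coord j oU Cf.
apply: etrans (E u v) (etrans _ (esym (E v u))).
exact: (derive_sym u v oU Up Cj).
Qed.

(** Leibniz rule at a zero of [h]: only the derivative of [h] survives. *)
Lemma derive_scale_vanish {R : realType} (V : normedModType R) n
    (h : V -> R) (f : V -> 'rV[R]_n) x v :
  differentiable h x -> differentiable f x -> h x = 0 ->
  derivable (fun y => h y *: f y) x v /\
  'D_v (fun y => h y *: f y) x = 'D_v h x *: f x.
Proof.
move=> dh df h0.
have dhf j : is_derive x v (fun y => h y * f y 0 j) (f x 0 j * 'D_v h x).
  have dfj : derivable (fun y => f y 0 j) x v.
    by apply: (derivable_mxP _ _ _).1; exact: diff_derivable.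
  have dhx : derivable h x v by exact: diff_derivable.
  have := is_deriveM (derivableP dhx) (derivableP dfj).
  by rewrite h0 scale0r add0r.
have hfE i j : (fun y => (h y *: f y) i j) = (fun y => h y * f y 0 j).
  by apply/funext => y; rewrite mxE (ord1 i).
have D : derivable (fun y => h y *: f y) x v.
  by apply/derivable_mxP => i j; rewrite hfE; have [] := dhf j.
split=> //; rewrite derive_mx//; apply/rowP => j.
by rewrite !mxE hfE; have [_ ->] := dhf j; rewrite mulrC.
Qed.

(** If the symmetric form [B] is complex linear in one argument when the other is
    [a], [J a] or [J u], then
    [J B(J a, u) = B(J a, J u) = J B(J u, a) = J (J B(a, u))], and [J] cancels. *)
Lemma symmetric_complex_linear {V : zmodType} (J : {additive V -> V})
    (B : V -> V -> V) a u :
  (forall v, J (J v) = - v) -> (forall x y, B x y = B y x) ->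
  (forall v, B a (J v) = J (B a v)) ->
  (forall v, B (J a) (J v) = J (B (J a) v)) ->
  (forall v, B (J u) (J v) = J (B (J u) v)) ->
  B u (J a) = J (B u a).
Proof.
move=> JJ sym Ba BJa BJu; apply: oppr_inj; rewrite -JJ.
by rewrite (sym u (J a)) -BJa (sym (J a)) BJu (sym (J u)) Ba JJ (sym u).
Qed.

(** Differentiating the perturbed Cauchy-Riemann equation at a zero of [h]
    gives [B(d, J v) + dh(d) P_v = J B(d, v)] for the second differential [B] of
    [phi]; [symmetric_complex_linear] applies to the directions killed by
    [dh]. *)
Lemma cauchy_riemann_obstruction {R : realType} n
    (J : {linear 'rV[R]_n -> 'rV[R]_n}) (U : set 'rV[R]_n)
    (phi : 'rV[R]_n -> 'rV[R]_n) (h : 'rV[R]_n -> R)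
    (P : 'rV[R]_n -> 'rV[R]_n -> 'rV[R]_n) (x a u : 'rV[R]_n) :
  (forall v, J (J v) = - v) -> open U -> U x -> Ck_on U 2 phi ->
  differentiable h x -> h x = 0 -> (forall v, differentiable (P v) x) ->
  (forall y v, U y -> 'D_(J v) phi y + h y *: P v y = J ('D_v phi y)) ->
  'D_a h x = 0 -> 'D_(J a) h x = 0 -> 'D_(J u) h x = 0 ->
  'D_u h x *: P a x = 0.
Proof.
move=> JJ oU Ux Cphi dh h0 dP CR ha hja hju.
pose B d v := 'D_d ('D_v phi) x.
have nU : nbhs x U by exact: open_nbhs_nbhs.
have dD v : differentiable ('D_v phi) x by exact: ((Cphi.2 v).1 x Ux).
have CR1 d v : B d (J v) + 'D_d h x *: P v x = J (B d v).
  rewrite -[RHS](derive_lin_comp d (@linear_rV_continuous _ _ _ J) (dD v)).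
  have [dhP <-] := derive_scale_vanish d dh (dP v) h0.
  rewrite -(deriveD (diff_derivable (dD (J v))) dhP).
  apply: near_eq_derive; apply: filterS nU => y Uy.
  exact: CR.
have sym d v : B d v = B v d by exact: derive_sym_rV oU Ux Cphi.
have CR0 d v : 'D_d h x = 0 -> B d (J v) = J (B d v).
  by move=> d0; rewrite -CR1 d0 scale0r addr0.
have := CR1 u a.
rewrite (symmetric_complex_linear JJ sym) => [|v|v|v]; [|exact: CR0..].
by rewrite -[RHS]addr0 => /addrI.
Qed.

Section ComplexSpace.
Context {R : realType} {m : nat}.

Lemma J_std_linear : linear (@J_std R m).
Proof.
by move=> a u v; rewrite /J_std !linearP scale_row_mx add_row_mx.
Qed.

HB.instance Definition _ := GRing.isLinear.Build R _ _ _ (@J_std R m) J_std_linear.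

Lemma J_stdK (v : 'rV[R]_(m + m)) : J_std (J_std v) = - v.
Proof.
by rewrite /J_std row_mxKl row_mxKr -opp_row_mx hsubmxK.
Qed.

Lemma J_std_lshift (i : 'I_m) :
  J_std (delta_mx 0 (lshift m i)) = delta_mx 0 (rshift m i) :> 'rV[R]_(m + m).
Proof.
apply/rowP => k; rewrite /J_std !mxE; case: splitP => j kj; rewrite !mxE /=.
  rewrite eq_rlshift oppr0 -(inj_eq val_inj) /= kj.
  by case: eqP => // E; have := ltn_ord j; rewrite E ltnNge leq_addr.
by rewrite eq_lshift -[k == _](inj_eq val_inj) /= kj eqn_add2l.
Qed.

End ComplexSpace.

(** * The twisted almost complex structures *)

Section TwistedStructure.
Context {R : realType} {n : nat} {M : manifold R n}.
Context (g0 : bilin_field M) (J0 : endo_field M) (ak : almost_kahler g0 J0).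
Context (z : chart R M n) (a : 'rV[R]_n) (az : atlas z).
Context (H : 'rV[R]_n -> R) (sH : smooth_on setT H).
Context (K : set M) (cK : compact K) (Kz : K `<=` chart_dom z).
Context (HK : forall p, chart_dom z p -> H (chart_map z p) != 0 -> K p).

Let om := fundamental_form g0 J0.

(** The function [H] of the coordinates, extended by zero to the manifold; it is
    smooth there because [H] vanishes off the compact set [K]. *)
Definition cutoff (p : M) : R :=
  if p \in chart_dom z then H (chart_map z p) else 0.

Definition twisted (t : R) : endo_field M := fun c p v =>
  twist (om c p) (J0 c p) (t * cutoff p) (change_coord z c p a) v.

Lemma g0_metric : riemannian_metric g0. Proof. by have [[]] := ak. Qed.
Lemma J0_acs : almost_complex J0. Proof. by have [[]] := ak. Qed.

Lemma om_bilinear c p : atlas c -> chart_dom c p ->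
  (forall u, scalar (om c p u)) /\ (forall v, scalar (fun u => om c p u v)).
Proof.
move=> ac cp; have [[gl _ _] _] := g0_metric; have [[Jl _ _] _] := J0_acs.
have [gl1 gl2] := gl _ _ ac cp; have Jlin := Jl _ _ ac cp.
split=> [u x y v|v x y u]; rewrite /om /fundamental_form; first exact: gl1.
by rewrite Jlin gl2.
Qed.

(** Invariance and symmetry of the metric give
    [g0(J0 v, v) = g0(J0 (J0 v), J0 v) = - g0(J0 v, v)]. *)
Lemma om_alternating c p : atlas c -> chart_dom c p -> forall v, om c p v v = 0.
Proof.
move=> ac cp v; have [_ sp] := g0_metric; have [gs _] := sp _ _ ac cp.
have [[_ _ inv] _] := ak; have [_ JJ] := J0_acs.
have bl := om_bilinear ac cp.
have om0 : om c p v 0 = 0.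
  by have := bl.1 v 1 0 0; rewrite scaler0 addr0 => om0; lra.
have E : om c p v v = - om c p v v.
  transitivity (om c p v (- v)).
    by rewrite {1}/om /fundamental_form -(inv _ _ ac cp) JJ// gs.
  by have := bl.1 v (- 1) v 0; rewrite addr0 scaleN1r om0 => ->; ring.
by lra.
Qed.

Lemma om_J0 c p : atlas c -> chart_dom c p ->
  forall u v, om c p (J0 c p u) (J0 c p v) = om c p u v.
Proof. by move=> ac cp u v; have [[_ _ inv] _] := ak; exact: inv. Qed.

Lemma om_tensor c d p u v : atlas c -> atlas d -> chart_dom c p -> chart_dom d p ->
  om c p u v = om d p (change_coord c d p u) (change_coord c d p v).
Proof.
move=> ac ad cp dp; have [[_ gt _] _] := g0_metric; have [[_ Jt _] _] := J0_acs.
by rewrite /om /fundamental_form (gt c d)// Jt.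
Qed.

Lemma cutoff_support p : ~ K p -> cutoff p = 0.
Proof.
move=> nK; rewrite /cutoff; case: ifPn => // /set_mem zp.
by apply/eqP; apply: contraT => /(HK zp).
Qed.

Lemma cutoff_chart p : chart_dom z p -> cutoff p = H (chart_map z p).
Proof. by move=> zp; rewrite /cutoff mem_set. Qed.

Lemma cutoff_outside p : ~ chart_dom z p -> cutoff p = 0.
Proof. by move=> zp; rewrite /cutoff memNset. Qed.

Lemma twisted_cutoff0 t c p v : t * cutoff p = 0 -> twisted t c p v = J0 c p v.
Proof. by rewrite /twisted => ->; exact: twist0. Qed.

Lemma twisted_tensor t c d p v : atlas c -> atlas d ->
  chart_dom c p -> chart_dom d p ->
  change_coord c d p (twisted t c p v) = twisted t d p (change_coord c d p v).
Proof.
move=> ac ad cp dp; have [[_ Jt _] _] := J0_acs.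
have [zp|nzp] := pselect (chart_dom z p); last first.
  by rewrite !twisted_cutoff0 ?cutoff_outside ?mulr0// Jt.
rewrite /twisted -(change_coord_comp a az ac ad)//.
by apply: twist_natural => [x y|x]; [exact: om_tensor|exact: Jt].
Qed.

(** Near a point of the domain of [z] the structure is built from smooth fields;
    elsewhere the point has a neighbourhood that misses [K], closed because [M]
    is Hausdorff, and there the structure is [J0].  Space and time are allowed to
    depend on a common parameter, which covers both the smoothness of each
    structure and the joint smoothness of the family. *)
Lemma twisted_smooth {V : normedModType R} (U : set V) (psi : V -> 'rV[R]_n)
    (tau : V -> R) c v k : atlas c -> open U ->
  (forall x, U x -> chart_cod c (psi x)) ->
  Ck_on U k psi -> Ck_on U k tau ->
  Ck_on U k (fun x => twisted (tau x) c (chart_inv c (psi x)) v).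
Proof.
move=> ac oU Upsi Cpsi Ctau.
have cpsi x : U x -> {for x, continuous psi}.
  by elim: (k) Cpsi => [|l IH]; [exact|move=> /Ck_onW].
have pull A : open A -> open (U `&` psi @^-1` (chart_map c @` (chart_dom c `&` A))).
  by move=> oA; apply: open_preimage_on => //; exact: open_chart_image.
have Jsm := J0_acs.1; have gsm := g0_metric.1.
apply: Ck_on_local => x Ux.
have [zp|nzp] := pselect (chart_dom z (chart_inv c (psi x))).
- have oz := pull _ (@chart_dom_open _ _ _ z).
  set U' := _ `&` _ in oz; exists U'.
    split=> //; exists (chart_inv c (psi x)); last by rewrite chart_invK//; exact: Upsi.
    by split=> //; apply: chart_inv_dom; exact: Upsi.
  have sub : U' `<=` U by move=> y [].
  have Cpsi' := Ck_on_subset sub Cpsi; have Ctau' := Ck_on_subset sub Ctau.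
  have U'psi y : U' y -> chart_cod c (psi y) by move=> /sub/Upsi.
  have CX : Ck_on U' k (fun y => change_coord z c (chart_inv c (psi y)) a).
    have sm := change_coord_smooth a az ac k.
    apply: (Ck_on_comp_rV oz _ _ Cpsi' sm); last by move=> y [].
    by apply: open_chart_image; exact: chart_dom_open.
  have Ch : Ck_on U' k (fun y => H (transition c z (psi y))).
    have sm := transition_smooth ac az k.
    have Ct : Ck_on U' k (transition c z \o psi).
      apply: (Ck_on_comp_rV oz _ _ Cpsi' sm); last by move=> y [].
      by apply: open_chart_image; exact: chart_dom_open.
    by apply: (Ck_on_comp oz _ Ct (sH k)).
  have CJ Y : Ck_on U' k Y -> Ck_on U' k (fun y => J0 c (chart_inv c (psi y)) (Y y)).
    by move=> CY; apply: smooth_endo_apply.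
  have CT s Y : Ck_on U' k s -> Ck_on U' k Y -> Ck_on U' k (fun y =>
      transvection (om c (chart_inv c (psi y))) (s y)
        (change_coord z c (chart_inv c (psi y)) a) (Y y)).
    move=> Cs CY; apply: Ck_onD => //; apply: Ck_onZ => //; apply: Ck_onM => //.
    apply: (smooth_bilin_apply gsm ac oz U'psi Cpsi' _ CX); exact: CJ.
  apply: (@Ck_on_eq _ _ _ _ _ (fun y => twist (om c (chart_inv c (psi y)))
     (J0 c (chart_inv c (psi y))) (tau y * H (transition c z (psi y)))
     (change_coord z c (chart_inv c (psi y)) a) v)) => //.
    by move=> y [Uy /chart_imageP[_ _ zy _]]; rewrite /twisted cutoff_chart.
  have Cs : Ck_on U' k (fun y => tau y * H (transition c z (psi y))) by exact: Ck_onM.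
  apply: (CT).
    have -> : (fun y => - (tau y * H (transition c z (psi y)))) =
      (fun y => (- 1) * (tau y * H (transition c z (psi y)))).
      by apply/funext => y; rewrite mulN1r.
    by apply: Ck_onM => //; exact: Ck_on_cst.
  by apply: CJ; apply: CT => //; exact: Ck_on_cst.
- have oK : open (~` K).
    by apply: closed_openC; apply: compact_closed => //; exact: manifold_hausdorff.
  have oz := pull _ oK.
  set U' := _ `&` _ in oz; exists U'.
    split=> //; exists (chart_inv c (psi x)); last by rewrite chart_invK//; exact: Upsi.
    split; first by apply: chart_inv_dom; exact: Upsi.
    by move=> /Kz.
  have sub : U' `<=` U by move=> y [].
  have U'psi y : U' y -> chart_cod c (psi y) by move=> /sub/Upsi.
  apply: (@Ck_on_eq _ _ _ _ _ (fun y => J0 c (chart_inv c (psi y)) v)) => //.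
    move=> y [Uy /chart_imageP[_ _ zy _]].
    by rewrite twisted_cutoff0// cutoff_support ?mulr0.
  apply: smooth_endo_apply => //; first exact: Ck_on_subset sub Cpsi.
  exact: Ck_on_cst.
Qed.

Lemma twisted_chart_smooth t c v : atlas c ->
  smooth_on (chart_cod c) (fun x => twisted t c (chart_inv c x) v).
Proof.
move=> ac k; apply: (@twisted_smooth _ (chart_cod c) id (cst t)) => //.
- exact: chart_cod_open.
- exact: Ck_on_id.
- exact: Ck_on_cst.
Qed.

Lemma twisted_acs t : almost_complex (twisted t).
Proof.
have [[Jl _ _] JJ] := J0_acs; split; first split.
- move=> c p ac cp; apply: twist_linear; [exact: om_bilinear|exact: Jl].
- by move=> *; exact: twisted_tensor.
- by move=> c ac v; exact: twisted_chart_smooth.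
move=> c p ac cp v; apply: twistK; [exact: om_bilinear|exact: om_alternating|].
exact: JJ.
Qed.

Lemma twisted_symplectic t c p u v : atlas c -> chart_dom c p ->
  om c p (twisted t c p u) (twisted t c p v) = om c p u v.
Proof.
move=> ac cp; apply: twist_symplectic; [exact: om_bilinear|exact: om_alternating|].
exact: om_J0.
Qed.

Lemma twisted_metric t c p u v : atlas c -> chart_dom c p ->
  form_metric om (twisted t) c p u v =
  g0 c p (transvection (om c p) (t * cutoff p) (change_coord z c p a) u)
         (transvection (om c p) (t * cutoff p) (change_coord z c p a) v).
Proof.
move=> ac cp; rewrite /form_metric /twisted twist_metric; last 2 first.
- exact: om_bilinear.
- exact: om_alternating.
by have [[_ _ inv] _] := ak; rewrite {1}/om /fundamental_form inv.
Qed.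

Lemma twisted_compatible t : form_compatible om (twisted t).
Proof.
have [gsm gP] := g0_metric; have [[Tl Tt Ts] TT] := twisted_acs t.
split; last first.
  move=> c p ac cp u v; rewrite /form_metric.
  by rewrite twisted_symplectic.
split; first split.
- move=> c p ac cp; have [bl1 bl2] := om_bilinear ac cp.
  split=> [u x v w|v]; rewrite /form_metric; last exact: bl2.
  by rewrite Tl// bl1.
- move=> c d p ac ad cp dp u v; rewrite /form_metric (@om_tensor c d)//.
  by rewrite twisted_tensor.
- move=> c ac u v k; rewrite /form_metric /om /fundamental_form.
  have oc : open (chart_cod c) by exact: chart_cod_open.
  apply: (smooth_bilin_apply (psi := id) gsm ac oc) => //.
  + exact: Ck_on_id.
  + by have [_ _ Jsm] := J0_acs.1; exact: Jsm.
  + exact: twisted_chart_smooth.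
move=> c p ac cp; have [gsym gpos] := gP _ _ ac cp.
split=> [u v|v v0]; first by rewrite !twisted_metric// gsym.
rewrite twisted_metric//; apply: gpos.
apply: contraNneq v0 => T0.
rewrite -(transvectionK (om_bilinear ac cp) (om_alternating ac cp)
  (t * cutoff p) (change_coord z c p a) v) T0 /transvection.
have [_ bl2] := om_bilinear ac cp.
have om0 x : om c p 0 x = 0.
  by have := bl2 x 1 0 0; rewrite scaler0 addr0 => om0; lra.
by rewrite om0 mulr0 scale0r addr0.
Qed.

(** The fundamental form of the twisted metric is [om] itself, because the
    twisted structure preserves [om]. *)
Lemma twisted_almost_kahler t : almost_kahler (form_metric om (twisted t)) (twisted t).
Proof.
have [met inv] := twisted_compatible t.
split; first by split=> //; exact: twisted_acs.
move=> c x ac cx u v w; have [_ closed0] := ak; rewrite -(closed0 c x ac cx u v w).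
have nc : nbhs x (chart_cod c).
  by apply: open_nbhs_nbhs; split=> //; exact: chart_cod_open.
have E d r s : 'D_d (fun y => fundamental_form (form_metric om (twisted t))
    (twisted t) c (chart_inv c y) r s) x =
    'D_d (fun y => fundamental_form g0 J0 c (chart_inv c y) r s) x.
  apply: near_eq_derive; apply: filterS nc => y cy.
  rewrite {1}/fundamental_form /form_metric twisted_symplectic//.
  exact: chart_inv_dom.
by rewrite /ext_d !E.
Qed.

Lemma twisted_deformation : smooth_compact_deformation J0 twisted.
Proof.
exists (- 1), 1; split.
- by rewrite ltrN10 ltr01.
- by move=> t _; exact: twisted_acs.
- move=> c ac v k.
  have fstl : linear (@fst R 'rV[R]_n) by [].
  have sndl : linear (@snd R 'rV[R]_n) by [].
  pose HF := GRing.isLinear.Build _ _ _ _ _ fstl.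
  pose HS := GRing.isLinear.Build _ _ _ _ _ sndl.
  pose F : {linear (R * 'rV[R]_n)%type -> R} := HB.pack (@fst R 'rV[R]_n) HF.
  pose S : {linear (R * 'rV[R]_n)%type -> 'rV[R]_n} := HB.pack (@snd R 'rV[R]_n) HS.
  apply: (@twisted_smooth _ _ snd fst) => //.
  + have -> : [set tx : R * 'rV[R]_n | -1 < tx.1 < 1 /\ chart_cod c tx.2] =
      (fst @^-1` [set` `]-1, 1[]) `&` (snd @^-1` chart_cod c).
      by apply/seteqP; split=> x /=; rewrite in_itv.
    apply: openI; apply: open_comp.
    * by move=> x _; exact: cvg_fst.
    * exact: interval_open.
    * by move=> x _; exact: cvg_snd.
    * exact: chart_cod_open.
  + by move=> tx [].
  + by apply: (Ck_on_linear _ k (f := S)) => x; exact: cvg_snd.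
  + by apply: (Ck_on_linear _ k (f := F)) => x; exact: cvg_fst.
- by move=> c p ac cp; apply/funext => v; rewrite twisted_cutoff0// mul0r.
- exists K => // t c p _ ac cp nK; apply/funext => v.
  by rewrite twisted_cutoff0// cutoff_support ?mulr0.
Qed.

End TwistedStructure.

(** * Non-integrability and the theorem *)

(** In the coordinates [z] the twisted structure is [J_std v + H Q_v] with [Q_v]
    smooth ([twist_expand]), and [Q_a] at [q] is [t g0(a, a)] times [a].  The
    image [P_v] of [Q_v] under a change of holomorphic coordinates is the
    perturbation to which [cauchy_riemann_obstruction] applies. *)
Lemma twisted_not_integrable {R : realType} {m : nat} {M : manifold R (m + m)}
    (g0 : bilin_field M) (J0 : endo_field M) (z : chart R M (m + m))
    (a u : 'rV[R]_(m + m)) (H : 'rV[R]_(m + m) -> R) (q : M) (t : R) :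
  almost_kahler g0 J0 -> atlas z -> smooth_on setT H ->
  (forall p, chart_dom z p -> forall v, J0 z p v = J_std v) ->
  chart_dom z q -> a != 0 -> t != 0 -> H (chart_map z q) = 0 ->
  'D_a H (chart_map z q) = 0 -> 'D_(J_std a) H (chart_map z q) = 0 ->
  'D_(J_std u) H (chart_map z q) = 0 -> 'D_u H (chart_map z q) != 0 ->
  ~ integrable_acs (twisted g0 J0 z a H t).
Proof.
move=> ak az sH Jz zq a0 t0 H0 Ha HJa HJu Hu /(_ q) [w [aw wq Jw]].
pose om := fundamental_form g0 J0.
pose U := chart_map z @` (chart_dom z `&` chart_dom w).
pose phi := transition z w.
have oU : open U by apply: open_chart_image; exact: chart_dom_open.
have Uq : U (chart_map z q) by exact: overlap_image.
have Cphi k : Ck_on U k phi by exact: transition_smooth.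
have CD v : Ck_on U 1 ('D_v phi) by exact: ((Cphi 2).2 v).
have CH : Ck_on U 1 H by apply: Ck_on_subset (sH 1).
pose W v y := om z (chart_inv z y) v a.
have CW v : Ck_on U 1 (W v).
  have Ucod y : U y -> chart_cod z y by move=> /chart_imageP[].
  have [_ _ Jsm] := (J0_acs ak).1.
  apply: (smooth_bilin_apply (psi := id) (g0_metric ak).1 az oU Ucod).
  - exact: Ck_on_id.
  - exact: Ck_on_subset Ucod (Jsm z az v 1).
  - exact: Ck_on_cst.
pose P v y := t *: (W v y *: 'D_(J_std a) phi y +
  (- 1 * W (J_std v) y + - t * (H y * (W v y * W (J_std a) y))) *: 'D_a phi y).
have CP v : Ck_on U 1 (P v).
  have Cc (c : R) : Ck_on U 1 (cst c) by exact: Ck_on_cst.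
  have CQ := Ck_onD oU (Ck_onM oU (Cc (- 1)) (CW (J_std v)))
    (Ck_onM oU (Cc (- t)) (Ck_onM oU CH (Ck_onM oU (CW v) (CW (J_std a))))).
  exact: (Ck_onZ oU (Cc t) (Ck_onD oU (Ck_onZ oU (CW v) (CD _)) (Ck_onZ oU CQ (CD a)))).
(* The Cauchy-Riemann equations of the chart [w] for the twisted structure. *)
have CR y v : U y -> 'D_(J_std v) phi y + H y *: P v y = J_std ('D_v phi y).
  move=> /chart_imageP[zy zp wp py]; set p := chart_inv z y in zp wp py *.
  have Dphi x : 'D_x phi y = change_coord z w p x.
    by rewrite (change_coord_derive _ az aw zp wp) py.
  rewrite /P !Dphi -[in RHS](Jw p wp) -twisted_tensor//.
  have -> : twisted g0 J0 z a H t z p v =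
      J_std v + (t * H y) *: (W v y *: J_std a +
       (- 1 * W (J_std v) y + - t * (H y * (W v y * W (J_std a) y))) *: a).
    rewrite /twisted change_coord_id// cutoff_chart// py.
    have [[Jl _ _] _] := J0_acs ak.
    rewrite (twist_expand (om_bilinear ak az zp) (Jl _ _ az zp)) !Jz//.
    congr (_ + _ *: (_ + _ *: _)); rewrite /W /om -/p; ring.
  have LE (L : {linear 'rV[R]_(m + m) -> 'rV[R]_(m + m)}) x1 x2 x3 s1 s2 s3 :
      L (x1 + s1 *: (s2 *: x2 + s3 *: x3)) =
      L x1 + s1 *: (s2 *: L x2 + s3 *: L x3).
    by rewrite linearD linearZ /= linearD !linearZ.
  apply: etrans (esym (LE ('d (transition z w) (chart_map z p)) _ _ _ _ _ _)).
  by rewrite scalerA (mulrC (H y)).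
have dP v : differentiable (P v) (chart_map z q) by exact: ((CP v).1 _ Uq).
have dH : differentiable H (chart_map z q) by exact: (CH.1 _ Uq).
have := cauchy_riemann_obstruction (J := @J_std R m)
  (@J_stdK R m) oU Uq (Cphi 2) dH H0 dP CR Ha HJa HJu.
move/eqP; rewrite scaler_eq0 (negbTE Hu) /= /P.
(* At [q] only the coefficient of [D phi a] remains in [P a], and it is
   proportional to the squared length of [a]. *)
have Wa : W a (chart_map z q) = 0 by rewrite /W chart_mapK//; exact: om_alternating.
rewrite Wa H0 scale0r add0r mul0r mulr0 addr0 scaler_eq0 (negbTE t0) /=.
rewrite scaler_eq0 mulN1r oppr_eq0.
have WJa : W (J_std a) (chart_map z q) != 0.
  rewrite /W chart_mapK// -(Jz q zq) /om.
  rewrite (alternating_skew (om_bilinear ak az zq) (om_alternating ak az zq)).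
  rewrite oppr_eq0 gt_eqF// /fundamental_form.
  have [[met _ inv] _] := ak.
  by rewrite inv//; exact: (met.2 z q az zq).2.
rewrite (negbTE WJa) /= => /eqP Da.
have : change_coord z w q a = 0 by rewrite change_coord_derive.
move=> E; have := change_coord_comp a az aw az zq wq zq.
rewrite E change_coord_id// /change_coord linear0 => a00.
by rewrite -a00 eqxx in a0.
Qed.

Theorem theorem1p12 (R : realType) (m : nat) (M : manifold R (m + m))
    (g0 : bilin_field M) (J0 : endo_field M)
    (dim_gt2 : (1 < m)%N) (M_nonempty : [set: M] !=set0)
    (kahlerM : kahler g0 J0) :
  let om0 := fundamental_form g0 J0 in
  exists J : R -> endo_field M,
    smooth_compact_deformation J0 J /\
    \forall t \near 0^',
      [/\ form_compatible om0 (J t),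
          ~ integrable_acs (J t)
        & strictly_almost_kahler (form_metric om0 (J t)) (J t)].
Proof.
move=> om0; have [ak int0] := kahlerM; have [q _] := M_nonempty.
have [z [az zq Jz]] := int0 q.
pose x0 := chart_map z q.
pose i0 : 'I_m := Ordinal (ltnW dim_gt2).
pose i1 : 'I_m := Ordinal dim_gt2.
pose a : 'rV[R]_(m + m) := delta_mx 0 (lshift m i0).
pose u : 'rV[R]_(m + m) := delta_mx 0 (lshift m i1).
have /nbhs_ballP[r /= r0 rcod] : nbhs x0 (chart_cod z).
  by apply: open_nbhs_nbhs; split; [exact: chart_cod_open|exact: chart_cod_map].
have r20 : 0 < r / 2 by rewrite divr_gt0.
have [b [bsm b0 bsupp]] := bump_exists x0 r20.
pose l (y : 'rV[R]_(m + m)) : R := y 0 (lshift m i1) + - x0 0 (lshift m i1).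
have lsm : smooth_on setT l.
  move=> k; apply: Ck_onD; [exact: openT| |exact: Ck_on_cst].
  by apply: Ck_on_coord; [exact: openT|exact: Ck_on_id].
(* [H] vanishes at [x0] and its differential there is a nonzero multiple of the
   real coordinate along [u]. *)
pose H y := b y * l y.
have sH : smooth_on setT H by move=> k; apply: Ck_onM => //; exact: openT.
have DH v : 'D_v H x0 = b x0 * v 0 (lshift m i1).
  have db : derivable b x0 v by apply: diff_derivable; exact: ((bsm 1).1 x0 I).
  have dl : derivable l x0 v by apply: diff_derivable; exact: ((lsm 1).1 x0 I).
  have did : differentiable (id : 'rV[R]_(m + m) -> 'rV[R]_(m + m)) x0 by [].
  have Dl : 'D_v l x0 = v 0 (lshift m i1).
    rewrite -[v in RHS](derive_id x0) derive_coord//.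
    have dc : derivable (fun y : 'rV[R]_(m + m) => y 0 (lshift m i1) : R) x0 v.
      exact/diff_derivable/differentiable_coord.
    have [_ ->] := is_deriveD (derivableP dc)
      (is_derive_cst (- x0 0 (lshift m i1)) x0 v).
    by rewrite addr0.
  have [_ ->] := is_deriveM (derivableP db) (derivableP dl).
  by rewrite Dl /l subrr scale0r addr0.
pose B := [set y : 'rV[R]_(m + m) | `|x0 - y| <= r / 2].
have Bcod : B `<=` chart_cod z.
  move=> y By; apply: rcod; rewrite -ball_normE /= (le_lt_trans By)//.
  by rewrite ltr_pdivrMr// ltr_pMr// ltr1n.
have cB : compact B.
  apply: bounded_closed_compact; last first.
    have -> : B = closed_ball x0 (r / 2) by rewrite closed_ballE.
    exact: closed_ball_closed.
  exists (r / 2 + `|x0|); split; first exact: num_real.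
  move=> N /ltW leN y /= By; apply: le_trans leN.
  by rewrite -(subKr x0 y) (le_trans (ler_normB _ _))// addrC lerD.
pose K := chart_inv z @` B.
have cK : compact K.
  apply: continuous_compact cB; apply: continuous_in_subspaceT => y /set_mem By.
  by apply: chart_inv_cont; exact: Bcod.
have Kz : K `<=` chart_dom z by move=> _ [y By <-]; apply: chart_inv_dom; exact: Bcod.
have HK p : chart_dom z p -> H (chart_map z p) != 0 -> K p.
  move=> zp; rewrite mulf_eq0 negb_or => /andP[/bsupp/ltW bp _].
  by exists (chart_map z p) => //; exact: chart_mapK.
exists (twisted g0 J0 z a H); split.
  exact: (twisted_deformation ak a az sH cK Kz HK).
have Hx0 : H x0 = 0 by rewrite /H /l subrr mulr0.
have nint t : t != 0 -> ~ integrable_acs (twisted g0 J0 z a H t).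
  move=> t0; apply: (twisted_not_integrable (u := u) ak az sH Jz zq _ t0 Hx0).
  - apply/eqP => /matrixP/(_ 0 (lshift m i0)); rewrite !mxE !eqxx /=.
    by apply/eqP; exact: oner_neq0.
  - by rewrite DH mxE /= mulr0.
  - by rewrite DH J_std_lshift mxE eq_lrshift andbF mulr0.
  - by rewrite DH J_std_lshift mxE eq_lrshift andbF mulr0.
  - by rewrite DH mxE !eqxx mulr1 gt_eqF.
near=> t.
have t0 : t != 0 by near: t; exact: nbhs_dnbhs_neq.
split.
- exact: (twisted_compatible ak a az sH cK Kz HK).
- exact: nint.
- split; last exact: nint.
  exact: (twisted_almost_kahler ak a az sH cK Kz HK).
Unshelve. all: by end_near. Qed.
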